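(* Let $p\ge 5$ be a prime and let $r$ be an integer with $1\le r\le p-1$ such that $4r+1\equiv 0\pmod p$. Then for all integers $n\ge 0$ and all integers $k\ge j\ge 0$, \[ a_{p(k-j)+(p-3),\;pk+p}(pn+r)\equiv 0 \pmod p. \]
   Context: For positive integers $r,s$, $a_{r,s}(n)$ denotes the number of multicolored partitions of $n$ in which each even part may appear in one of $r$ colors and each odd part may appear in one of $s$ colors (copies of the same part size in different colors are distinct), with $a_{r,s}(0)=1$. Equivalently, for $|q|<1$, $\sum_{n\ge0}a_{r,s}(n)q^n = f_2^{s-r}/f_1^{s}$, where $f_m=\prod_{i\ge1}(1-q^{mi})$. *)

(* Defs.v *)
From mathcomp Require Import all_boot.

Set Implicit Arguments.
Unset Strict Implicit.
Unset Printing Implicit Defensive.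

Definition num_colors (r s m : nat) : nat := if odd m then s else r.

(* [existT _ i c] is the part of size [i.+1] in color [c].  Only sizes 1, ..., n
   are listed, since no other part can occur in a partition of [n]. *)
Definition colored_part (r s n : nat) : finType :=
  {i : 'I_n & 'I_(num_colors r s i.+1)}.

Definition part_size (r s n : nat) (c : colored_part r s n) : nat :=
  (tag c).+1.

(* A multicolored partition of [n] is given by the multiplicities [mu c] of the
   colored parts; a multiplicity never exceeds [n], hence the codomain. *)
Definition colored_partitions (r s n : nat) :
    {set {ffun colored_part r s n -> 'I_n.+1}} :=
  [set mu : {ffun colored_part r s n -> 'I_n.+1} |
    \sum_(c : colored_part r s n) mu c * part_size c == n].

Definition a (r s n : nat) : nat := #|colored_partitions r s n|.

(* Main.v *)
Require Import Defs.
From mathcomp Require Import all_boot.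
From mathcomp Require Import all_algebra zify ring.

(** The two color numbers are [0] and [-3] modulo [p], so Frobenius turns the
    generating function modulo [p] into a series in [q^p] times the cube of
    [\prod_(i >= 1) (1 - q^(2i))], which by Jacobi's identity is
    [\sum_m (-1)^m (2m+1) q^(m(m+1))].  An exponent [m(m+1)] congruent to [r]
    satisfies [(2m+1)^2 = 4m(m+1) + 1 = 4r + 1 = 0] modulo [p], so its coefficient
    vanishes.  Power series are replaced by polynomials modulo [X^(N+1)], and
    Jacobi's identity is obtained by differentiating the finite q-binomial theorem. *)

Set Implicit Arguments.
Unset Strict Implicit.
Unset Printing Implicit Defensive.

Import GRing.Theory.
Local Open Scope ring_scope.

(** * Gaussian binomials and the finite q-binomial theorem *)

Section GaussBinomial.

Variable R : comNzRingType.
Implicit Types (q y z : R).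

Definition qfact q n : R := \prod_(i < n) (1 - q ^+ i.+1).

Lemma qfactS q n : qfact q n.+1 = qfact q n * (1 - q ^+ n.+1).
Proof. by rewrite /qfact big_ord_recr. Qed.

(* [gauss q m k] is the Gaussian binomial coefficient [m + k choose k]_q. *)
Fixpoint gauss q m k : R :=
  match m, k with
  | m'.+1, k'.+1 => gauss q m' k + q ^+ m * (fix aux k0 : R :=
      match k0 with
      | 0 => 1
      | k1.+1 => gauss q m' k0 + q ^+ m * aux k1
      end) k'
  | _, _ => 1
  end.

Lemma gauss0n q k : gauss q 0 k = 1. Proof. by case: k. Qed.
Lemma gaussn0 q m : gauss q m 0 = 1. Proof. by case: m. Qed.

Lemma gaussS q m k :
  gauss q m.+1 k.+1 = gauss q m k.+1 + q ^+ m.+1 * gauss q m.+1 k.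
Proof. by case: k. Qed.

(** By induction both terms of the Pascal rule [gaussS] become multiples of the same q-factorial,
    and [1 - q^(m+k+2) = (1 - q^(m+1)) + q^(m+1) (1 - q^(k+1))] adds them up. *)
Lemma gauss_qfact q m k :
  gauss q m k * qfact q m * qfact q k = qfact q (m + k).
Proof.
elim: m k => [|m IHm] k; first by rewrite gauss0n {1}/qfact big_ord0 !mul1r.
elim: k => [|k IHk]; first by rewrite gaussn0 {2}/qfact big_ord0 mulr1 mul1r addn0.
have := IHm k.+1; rewrite -addSnnS => E1.
rewrite gaussS addnS (qfactS _ (_ + _)) qfactS [qfact q k.+1]qfactS.
have -> : q ^+ (m.+1 + k).+1 = q ^+ m.+1 * q ^+ k.+1 by rewrite -exprD addnS.
rewrite qfactS in E1; rewrite qfactS in IHk.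
transitivity ((1 - q ^+ m.+1) * (gauss q m k.+1 * qfact q m *
    (qfact q k * (1 - q ^+ k.+1)))
  + q ^+ m.+1 * (1 - q ^+ k.+1) * (gauss q m.+1 k *
    (qfact q m * (1 - q ^+ m.+1)) * qfact q k)); first by ring.
by rewrite E1 IHk; ring.
Qed.

(** The form homogeneous in [y] and [z] allows [y = q^n] without negative powers of [q]. Peeling off
    the last factor reduces the induction step to [gaussS]. *)
Lemma gauss_binomial q y z N :
  \prod_(i < N) (y + z * q ^+ i) =
  \sum_(k < N.+1) gauss q (N - k) k * q ^+ 'C(k, 2) * z ^+ k * y ^+ (N - k).
Proof.
elim: N => [|N IHN].
  by rewrite big_ord0 big_ord_recl big_ord0 /= bin0n !expr0 !mulr1 addr0.
rewrite big_ord_recr /= IHN mulrDr !mulr_suml.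
rewrite [in RHS]big_ord_recl [in RHS]big_ord_recr /=.
rewrite [in X in X + _]big_ord_recl [in X in _ + X]big_ord_recr /=.
rewrite /bump /= -[LHS]addrA; congr (_ + _).
  by rewrite !subn0 bin0n !gaussn0 exprSr; ring.
rewrite addrA -big_split /= !add1n; congr (_ + _); last first.
  by rewrite subSS subnn !gauss0n binS bin1 exprD exprS; ring.
apply: eq_bigr => -[i /= lti] _; rewrite !add1n subSS.
have -> : (N - i)%N = (N - i.+1).+1 by lia.
rewrite gaussS binS bin1 exprD !exprS.
have -> : q ^+ N = q ^+ (N - i.+1) * q ^+ i * q.
  by rewrite -exprD -exprSr; congr (_ ^+ _); lia.
ring.
Qed.

End GaussBinomial.

Lemma rmorph_gauss (R S : comNzRingType) (f : {rmorphism R -> S}) q m k :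
  f (gauss q m k) = gauss (f q) m k.
Proof.
elim: m k => [|m IHm] k; first by rewrite !gauss0n rmorph1.
elim: k => [|k IHk]; first by rewrite !gaussn0 rmorph1.
by rewrite !gaussS rmorphD rmorphM rmorphXn IHm IHk.
Qed.

Lemma mul_bin2 n : ('C(n, 2) * 2 = n * n.-1)%N.
Proof. by rewrite muln2 bin2 halfK oddM; case: n => //= n; rewrite andNb subn0. Qed.

(** * Congruences modulo powers of ['X] and Jacobi's identity *)

Section JacobiCube.

Variable F : fieldType.
Implicit Types A B C D : {poly F}.
Local Notation qf := (qfact ('X : {poly F})).
Local Notation g := (gauss ('X : {poly F})).

Definition eqmodX n A B := 'X^n %| A - B.

Lemma eqmodX_refl n A : eqmodX n A A.
Proof. by rewrite /eqmodX subrr dvdp0. Qed.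

Lemma eqmodX_sym n A B : eqmodX n A B -> eqmodX n B A.
Proof. by rewrite /eqmodX -(opprB B) dvdpNr. Qed.

Lemma eqmodX_trans n B A C : eqmodX n A B -> eqmodX n B C -> eqmodX n A C.
Proof.
move=> hAB hBC; rewrite /eqmodX.
have -> : A - C = (A - B) + (B - C) by ring.
by rewrite dvdp_add.
Qed.

Lemma eqmodX_leq m n A B : (m <= n)%N -> eqmodX n A B -> eqmodX m A B.
Proof. by move=> lemn; apply: dvdp_trans (dvdp_exp2l _ lemn). Qed.

Lemma eqmodXD n A B C D :
  eqmodX n A B -> eqmodX n C D -> eqmodX n (A + C) (B + D).
Proof.
move=> hAB hCD; rewrite /eqmodX.
have -> : A + C - (B + D) = (A - B) + (C - D) by ring.
by rewrite dvdp_add.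
Qed.

Lemma eqmodXM n A B C D :
  eqmodX n A B -> eqmodX n C D -> eqmodX n (A * C) (B * D).
Proof.
move=> hAB hCD; rewrite /eqmodX.
have -> : A * C - B * D = (A - B) * C + B * (C - D) by ring.
by rewrite dvdp_add //; [apply: dvdp_mulr | apply: dvdp_mull].
Qed.

Lemma eqmodX_exp n A B k : eqmodX n A B -> eqmodX n (A ^+ k) (B ^+ k).
Proof.
move=> hAB; elim: k => [|k IHk]; first exact: eqmodX_refl.
by rewrite !exprS; apply: eqmodXM.
Qed.

Lemma eqmodX_sum n (I : finType) (f h : I -> {poly F}) :
  (forall i, eqmodX n (f i) (h i)) -> eqmodX n (\sum_i f i) (\sum_i h i).
Proof.
move=> hfh; apply: (big_ind2 (fun A B => eqmodX n A B)) => //.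
  exact: eqmodX_refl.
by move=> *; apply: eqmodXD.
Qed.

Lemma eqmodX_prod n (I : finType) (f h : I -> {poly F}) :
  (forall i, eqmodX n (f i) (h i)) -> eqmodX n (\prod_i f i) (\prod_i h i).
Proof.
move=> hfh; apply: (big_ind2 (fun A B => eqmodX n A B)) => //.
  exact: eqmodX_refl.
by move=> *; apply: eqmodXM.
Qed.

Lemma eqmodX_coef n A B i : eqmodX n A B -> (i < n)%N -> A`_i = B`_i.
Proof.
move=> /dvdpP[C eAB] ltin; apply/eqP; rewrite -subr_eq0 -coefB eAB.
by rewrite coefMXn ltin.
Qed.

(** A polynomial with nonzero constant term is coprime to ['X^n]. *)
Lemma eqmodX_cancel n A B C :
  C`_0 != 0 -> eqmodX n (A * C) (B * C) -> eqmodX n A B.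
Proof.
move=> C0; rewrite /eqmodX -mulrBl Gauss_dvdpl //.
by rewrite coprimep_expl // coprimep_sym coprimepX rootE horner_coef0.
Qed.

Lemma qfact_coef0 n : (qf n)`_0 = 1.
Proof.
elim: n => [|n IHn]; first by rewrite /qfact big_ord0 coef1.
by rewrite qfactS coefM big_ord1 IHn mul1r coefB coef1 coefXn subr0.
Qed.

Lemma eqmodX_qfact m n : (m <= n)%N -> eqmodX m.+1 (qf n) (qf m).
Proof.
move=> /subnKC <-; elim: (n - m)%N => [|k IHk].
  by rewrite addn0; apply: eqmodX_refl.
rewrite addnS qfactS; apply: eqmodX_trans IHk; rewrite /eqmodX.
have -> : qf (m + k) * (1 - 'X ^+ (m + k).+1) - qf (m + k) =
  - (qf (m + k)) * 'X ^+ (m + k).+1 by ring.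
by rewrite dvdp_mull // dvdp_exp2l // ltnS leq_addr.
Qed.

(** The symmetry is hidden in the recursion but visible in [gauss_qfact], whose q-factorials cancel
    because their constant term is 1. *)
Lemma gauss_sym m k : g m k = g k m.
Proof.
have qf_neq0 i : qf i != 0.
  by apply: contra_neq (oner_neq0 F) => qf0; rewrite -(qfact_coef0 i) qf0 coef0.
apply: (mulIf (qf_neq0 m)); apply: (mulIf (qf_neq0 k)).
by rewrite gauss_qfact mulrAC gauss_qfact addnC.
Qed.

(** By [gauss_qfact], [g m k] is the quotient of [qf (m + k)] by [qf m * qf k], and all [qf] of
    index at least [m] agree modulo ['X^m.+1]. *)
Lemma eqmodX_qfact_gauss m n k :
  (m <= n)%N -> (m <= k)%N -> eqmodX m.+1 (qf n * g m k) 1.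
Proof.
move=> le_mn le_mk; apply: (@eqmodX_cancel _ _ _ (qf m * qf k)).
  by rewrite coefM big_ord1 !qfact_coef0 mul1r oner_neq0.
have -> : qf n * g m k * (qf m * qf k) = qf n * (g m k * qf m * qf k) by ring.
rewrite gauss_qfact mul1r; apply: (@eqmodX_trans _ (qf m * qf m)).
  by apply: eqmodXM; apply: eqmodX_qfact; rewrite ?leq_addr.
by apply: eqmodXM; [apply: eqmodX_refl | apply/eqmodX_sym/eqmodX_qfact].
Qed.

(** Each factor is [- 'X^i * (1 - 'X^(n - i))]. This product and the next one are the factors before
    and after the vanishing one in the proof of [qfact_sqr]. *)
Lemma prod_subX_low n :
  \prod_(i < n) ('X^n - 'X^i) = (-1) ^+ n * 'X^('C(n, 2)) * qf n :> {poly F}.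
Proof.
have -> : qf n = \prod_(i < n) (1 - 'X^(n - i)).
  rewrite /qfact (reindex_inj rev_ord_inj) /=; apply: eq_bigr => i _.
  by rewrite subnSK.
rewrite -(bin2_sum n) big_mkord -prodrXr.
have -> : (-1) ^+ n = \prod_(i < n) (-1) :> {poly F}.
  by rewrite prodr_const card_ord.
rewrite -!big_split /=.
apply: eq_bigr => i _.
rewrite mulN1r mulrBr mulr1 mulNr -exprD subnKC 1?ltnW //; ring.
Qed.

Lemma prod_subX_high n :
  \prod_(i < n) ('X^n - 'X^(n.+1 + i)) = 'X^(n * n) * qf n :> {poly F}.
Proof.
have -> : 'X^(n * n) = \prod_(i < n) 'X^n :> {poly F}.
  by rewrite prodr_const card_ord exprM.
rewrite -big_split /=.
apply: eq_bigr => i _.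
by rewrite mulrBr mulr1 -exprD addnS addSn.
Qed.

(** In the product rule only the term differentiating [1 - 'X] survives at 1. *)
Lemma deriv_at_root1 (R : comNzRingType) (c : R) (P : {poly R}) :
  ((c%:P * (1 - 'X) * P)^`()).[1] = - (c * P.[1]).
Proof. by rewrite !derivE !hornerE; ring. Qed.

(* The q-binomial theorem for the product of the [q^n - w q^i], [i <= 2n], is
   differentiated at the simple root [w = 1]; the terms [n - j] and [n + 1 + j]
   on the other side are paired up. *)
Lemma qfact_sqr n :
  qf n ^+ 2 = \sum_(j < n.+1)
    (-1) ^+ j * (2 * j + 1)%:R * 'X^('C(j.+1, 2)) * g (n - j) (n.+1 + j).
Proof.
pose N := (n + n.+1)%N.
pose c k : {poly F} := g (N - k) k * 'X^('C(k, 2)) * (-1) ^+ k * 'X^(n * (N - k)).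
(* The outer ['X] is the variable w and ['X%:P] is q. Among the [2n + 1] factors, the one of index
   [n] is [q^n (1 - w)]. *)
have := gauss_binomial ('X%:P : {poly {poly F}}) ('X%:P ^+ n) (- 'X) N.
move/(congr1 (fun P => P^`().[1])).
have -> : \sum_(k < N.+1) gauss ('X%:P : {poly {poly F}}) (N - k) k
      * 'X%:P ^+ 'C(k, 2) * (- 'X) ^+ k * ('X%:P ^+ n) ^+ (N - k)
    = \sum_(k < N.+1) (c k)%:P * 'X^k.
  apply: eq_bigr => k _; rewrite -exprM -rmorph_gauss /c [in LHS]exprNn.
  rewrite !rmorphM /= !rmorphXn /= rmorphN1; ring.
have -> : \prod_(i < N) ('X%:P ^+ n + - 'X * 'X%:P ^+ i) =
   ('X^n)%:P * (1 - 'X) * ((\prod_(i < n) ('X%:P ^+ n + - 'X * 'X%:P ^+ i))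
      * \prod_(i < n) ('X%:P ^+ n + - 'X * 'X%:P ^+ (n.+1 + i))) :> {poly {poly F}}.
  rewrite big_split_ord big_ord_recl /= addn0.
  rewrite mulrCA; congr (_ * (_ * _)); first by rewrite rmorphXn /=; ring.
  by apply: eq_bigr => i _; rewrite /bump /= add1n addnS -addSn.
rewrite deriv_at_root1 hornerM !horner_prod.
have hE m : ('X%:P ^+ n + - 'X * 'X%:P ^+ m : {poly {poly F}}).[1] = 'X^n - 'X^m.
  by rewrite -!rmorphXn /= mulNr hornerD hornerN hornerM hornerX !hornerC mul1r.
rewrite (eq_bigr (fun i : 'I_n => 'X^n - 'X^i) (fun i _ => hE _)).
rewrite (eq_bigr (fun i : 'I_n => 'X^n - 'X^(n.+1 + i)) (fun i _ => hE _)).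
rewrite prod_subX_low prod_subX_high.
rewrite raddf_sum horner_sum.
have dE k : ((c k)%:P * 'X^k)^`().[1] = c k * k%:R.
  by rewrite mul_polyC derivZ derivXn hornerZ hornerMn hornerXn expr1n.
rewrite (eq_bigr (fun k : 'I_N.+1 => c k * k%:R) (fun k _ => dE _)).
rewrite -[N.+1]/(n + n.+1).+1 -addSn big_split_ord /=.
(* Reversing the lower half pairs index [n - j] with index [n + 1 + j]. *)
rewrite (reindex_inj rev_ord_inj) -big_split /=.
(* Up to sign, the left side is [s * qf n ^+ 2]; [s] also factors out of every pair and is cancelled
   at the end. *)
pose e := ('C(n, 2) + n + n * n)%N; pose s : {poly F} := 'X^e * (-1) ^+ n.
have signB j : (j <= n)%N -> (-1) ^+ (n - j) = (-1) ^+ n * (-1) ^+ j :> {poly F}.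
  move=> lejn; rewrite -{2}(subnK lejn) exprD -mulrA -expr2.
  by rewrite sqrr_sign mulr1.
have cL j : (j <= n)%N -> c (n - j)%N =
    s * ((-1) ^+ j * 'X^('C(j.+1, 2)) * g (n - j) (n.+1 + j)).
  move=> lejn; rewrite /c (_ : (N - (n - j) = n.+1 + j)%N); last by lia.
  rewrite gauss_sym signB // /s.
  have -> : g (n - j) (n.+1 + j) * 'X^('C(n - j, 2)) * ((-1) ^+ n * (-1) ^+ j)
      * 'X^(n * (n.+1 + j)) = g (n - j) (n.+1 + j) * ((-1) ^+ n * (-1) ^+ j)
      * 'X^('C(n - j, 2) + n * (n.+1 + j)) by rewrite exprD; ring.
  have -> : ('C(n - j, 2) + n * (n.+1 + j) = e + 'C(j.+1, 2))%N.
    (* Doubled binomials give a polynomial identity; the case splits remove the predecessors. *)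
    move: (mul_bin2 (n - j)) (mul_bin2 n) (mul_bin2 j.+1); rewrite /e.
    rewrite -(subnK lejn) addnK.
    by case: (n - j)%N => [|m] /=; case: j {lejn} => [|j] /=; nia.
  rewrite exprD; ring.
(* The paired indices have opposite parity, so a pair contributes [c (n.+1 + j)] times the
   difference [2 * j + 1] of the indices. *)
have cR j : (j <= n)%N -> c (n.+1 + j)%N = - c (n - j)%N.
  move=> lejn; rewrite cL // /c (_ : (N - (n.+1 + j) = n - j)%N); last by lia.
  have -> : (-1) ^+ (n.+1 + j) = - ((-1) ^+ n * (-1) ^+ j) :> {poly F}.
    by rewrite exprD exprS mulN1r mulNr.
  have -> : g (n - j) (n.+1 + j) * 'X^('C(n.+1 + j, 2))
      * - ((-1) ^+ n * (-1) ^+ j) * 'X^(n * (n - j)) =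
      g (n - j) (n.+1 + j) * - ((-1) ^+ n * (-1) ^+ j)
      * 'X^('C(n.+1 + j, 2) + n * (n - j)) by rewrite exprD; ring.
  have -> : ('C(n.+1 + j, 2) + n * (n - j) = e + 'C(j.+1, 2))%N.
    move: (mul_bin2 (n.+1 + j)) (mul_bin2 n) (mul_bin2 j.+1); rewrite /e.
    rewrite -(subnK lejn) addnK.
    by case: (n - j)%N => [|m] /=; case: j {lejn} => [|j] /=; nia.
  rewrite exprD /s; ring.
have -> : 'X^n * ((-1) ^+ n * 'X^('C(n, 2)) * qf n * ('X^(n * n) * qf n)) =
    s * qf n ^+ 2 by rewrite /s /e !exprD; ring.
rewrite (eq_bigr (fun j : 'I_n.+1 => - (s * ((-1) ^+ j * (2 * j + 1)%:R
    * 'X^('C(j.+1, 2)) * g (n - j) (n.+1 + j))))); last first.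
  move=> [j /= ltj] _; rewrite subSS cR // cL //.
  have -> : (n.+1 + j)%:R = (n - j)%:R + (2 * j + 1)%:R :> {poly F}.
    by rewrite -natrD; congr (_%:R); lia.
  ring.
rewrite sumrN -mulr_sumr => /oppr_inj/mulfI; apply.
by rewrite mulf_neq0 ?signr_eq0 // monic_neq0 // monicXn.
Qed.

(** After multiplying [qfact_sqr] by [qf n], the Gaussian factor is 1 only modulo ['X^(n - j).+1];
    the missing [j] powers come from ['X^('C(j.+1, 2))]. *)
Lemma jacobi_cube n :
  eqmodX n.+1 (qf n ^+ 3)
    (\sum_(j < n.+1) ((-1) ^+ j * (2 * j + 1)%:R) * 'X^('C(j.+1, 2))).
Proof.
rewrite exprS qfact_sqr mulr_sumr; apply: eqmodX_sum => -[j /= ltj].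
have := @eqmodX_qfact_gauss (n - j) n (n.+1 + j) ltac:(lia) ltac:(lia).
rewrite /eqmodX => dvd_g.
set t := (-1) ^+ j * _.
have -> : qf n * (t * 'X^('C(j.+1, 2)) * g (n - j) (n.+1 + j))
    - t * 'X^('C(j.+1, 2))
  = t * ('X^('C(j.+1, 2)) * (qf n * g (n - j) (n.+1 + j) - 1)) by ring.
apply: dvdp_mull; apply: dvdp_trans (dvdp_mul (dvdpp _) dvd_g).
rewrite -exprD dvdp_exp2l //.
by move: (mul_bin2 j.+1) => /=; case: j ltj {t dvd_g} => [|j] ltj; nia.
Qed.

End JacobiCube.

(** * Generating function of colored partitions, and Frobenius *)

Definition geomX (R : comNzRingType) N i : {poly R} := \sum_(m < N.+1) 'X^(m * i).

(** Distributing the product over the sums gives one monomial per multiplicity function [mu]. The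
    equality is exact, since [geomX] has the same bound [N] as the multiplicities. *)
Lemma colored_partitions_coef (R : comNzRingType) r s N :
  (a r s N)%:R = (\prod_(i < N) geomX R N i.+1 ^+ num_colors r s i.+1)`_N.
Proof.
have -> : \prod_(i < N) geomX R N i.+1 ^+ num_colors r s i.+1 =
    \prod_(c : colored_part r s N) \sum_(m < N.+1) 'X^(m * part_size c).
  transitivity (\prod_(i < N) \prod_(c < num_colors r s i.+1) geomX R N i.+1).
    by apply: eq_bigr => i _; rewrite prodr_const card_ord.
  by rewrite sig_big_dep.
rewrite bigA_distr_bigA /= coef_sum /a -sum1_card natr_sum big_mkcond /=.
apply: eq_bigr => mu _; rewrite prodrXr coefXn inE eq_sym.
by case: eqP.
Qed.

(** The product telescopes to [1 - 'X^(i * N.+1)]. *)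
Lemma eqmodX_geomX (F : fieldType) N i :
  (0 < i)%N -> eqmodX N.+1 (geomX F N i * (1 - 'X^i)) 1.
Proof.
move=> i_gt0; rewrite /geomX mulrC.
under eq_bigr do rewrite mulnC exprM.
rewrite -opprB mulNr -subrX1 -exprM opprB /eqmodX addrAC subrr sub0r dvdpNr.
by rewrite dvdp_exp2l // leq_pmull.
Qed.

Lemma eqmodX_comp_sqr (F : fieldType) n (A B : {poly F}) :
  eqmodX n A B -> eqmodX (2 * n) (A \Po 'X^2) (B \Po 'X^2).
Proof.
move=> /dvdpP[C eAB]; rewrite /eqmodX -rmorphB /= eAB rmorphM /= comp_Xn_poly.
by rewrite -exprM dvdp_mull.
Qed.

Lemma prod_even_parts (R : comNzRingType) (q : R) N :
  \prod_(i < N) (if odd i.+1 then 1 else 1 - q ^+ i.+1) = qfact (q ^+ 2) N./2.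
Proof.
elim: N => [|N IHN]; first by rewrite /qfact !big_ord0.
rewrite big_ord_recr /= IHN uphalf_half.
have := odd_double_half N; case: (odd N) => /= eN; last by rewrite mulr1.
by rewrite qfactS -exprM; congr (_ * (1 - _ ^+ _)); lia.
Qed.

Lemma qfact_comp_sqr (R : comNzRingType) n :
  qfact ('X^2 : {poly R}) n = qfact 'X n \Po 'X^2.
Proof.
rewrite /qfact rmorph_prod; apply: eq_bigr => i _.
by rewrite rmorphB rmorph1 rmorphXn /= comp_polyX.
Qed.

(** Frobenius is additive, so [H ^+ p] is a polynomial in ['X^p]. *)
Lemma coef_expp (R : comNzRingType) p (H : {poly R}) i :
  p \in [pchar R] -> ~~ (p %| i)%N -> (H ^+ p)`_i = 0.
Proof.
move=> pcharRp ndvd_pi.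
have pcharPp : p \in [pchar {poly R}] by rewrite pchar_poly.
rewrite -(pFrobenius_autE pcharPp) -[H]coefK poly_def rmorph_sum coef_sum.
rewrite big1 // => k _; rewrite /= pFrobenius_autE exprZn -exprM coefZ coefXn.
by case: eqP ndvd_pi => [->|]; rewrite ?dvdn_mull // mulr0.
Qed.

(** [4 (N - j(j+1)) + (2j+1)^2 = 4N + 1]. *)
Lemma prime_dvd_pronic p N j :
  prime p -> (p %| 4 * N + 1)%N -> (j * j.+1 <= N)%N -> (p %| N - j * j.+1)%N ->
  (p %| 2 * j + 1)%N.
Proof.
move=> p_pr dvdN le_jN dvd_sub.
have : (p %| (2 * j + 1) ^ 2)%N.
  rewrite -(dvdn_addr _ (dvdn_mull 4 dvd_sub)).
  by rewrite (_ : (_ + _ = 4 * N + 1)%N) //; nia.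
by rewrite Euclid_dvdX // => /andP[].
Qed.

Local Close Scope ring_scope.

Theorem theorem1p14 (p r : nat) (p_prime : prime p) (p_ge5 : 5 <= p)
    (r_bounds : 1 <= r <= p - 1) (hr : 4 * r + 1 = 0 %[mod p])
    (n k j : nat) (le_jk : j <= k) :
  a (p * (k - j) + (p - 3)) (p * k + p) (p * n + r) = 0 %[mod p].
Proof.
set N := (p * n + r)%N; set R := (p * (k - j) + (p - 3))%N.
set S := (p * k + p)%N; pose F : fieldType := 'F_p.
have pcharFp : p \in [pchar F]%R by apply: pchar_Fp.
apply/eqP; rewrite mod0n -/(dvdn p _) (dvdn_pcharf pcharFp) colored_partitions_coef.
have dvdN : p %| 4 * N + 1.
  rewrite /N mulnDr -addnA dvdn_addr; last by rewrite mulnCA dvdn_mulr.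
  by rewrite /dvdn hr mod0n.
(* The color numbers are [S = p * k.+1] and [R = p * (k - j).+1 - 3]; [H] collects the exponents
   divided by [p], and the deficit 3 on even parts leaves the cube of [1 - 'X^i]. *)
pose H : {poly F} := (\prod_(i < N) geomX F N i.+1 ^+
   (if odd i.+1 then k.+1 else (k - j).+1))%R.
have gf_mod : eqmodX N.+1 (\prod_(i < N) geomX F N i.+1 ^+ num_colors R S i.+1)%R
    (H ^+ p * qfact ('X ^+ 2 : {poly F}) N./2 ^+ 3)%R.
  rewrite -prod_even_parts -!prodrXl -big_split /=.
  apply: eqmodX_prod => i; rewrite /num_colors /=; case: (odd i) => /=; last first.
    by rewrite expr1n mulr1 -exprM /S mulSn addnC mulnC; apply: eqmodX_refl.
  rewrite -exprM (_ : ((k - j).+1 * p = R + 3)%N); last by rewrite /R; nia.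
  rewrite exprD -mulrA -exprMn -{1}[(_ ^+ R)%R]mulr1.
  apply: eqmodXM; first exact: eqmodX_refl.
  rewrite -[X in eqmodX _ X](expr1n _ 3).
  by apply: eqmodX_exp; apply/eqmodX_sym/eqmodX_geomX.
have cube_mod : eqmodX N.+1 (qfact ('X ^+ 2 : {poly F}) N./2 ^+ 3)%R
    (\sum_(m < N./2.+1) (((-1) ^+ m * (2 * m + 1)%:R)%:P * 'X^(m * m.+1)))%R.
  rewrite qfact_comp_sqr -rmorphXn /=.
  have := eqmodX_comp_sqr (jacobi_cube F N./2).
  rewrite rmorph_sum /=.
  rewrite (eq_bigr (fun m : 'I_ _ =>
      (((-1) ^+ m * (2 * m + 1)%:R)%:P * 'X^(m * m.+1))%R)); last first.
    move=> m _; rewrite !rmorphM /= comp_Xn_poly -exprM rmorphXn rmorphN1.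
    rewrite !rmorph_nat rmorphXn rmorphN1; congr (_ * 'X^_)%R.
    by rewrite mulnC mul_bin2 mulnC.
  (* The substitution doubles the precision to [2 * N./2.+1], which is at least [N.+1] for either
     parity of [N]. *)
  by apply: eqmodX_leq; have := odd_double_half N; lia.
rewrite (eqmodX_coef gf_mod) // (eqmodX_coef (eqmodXM (eqmodX_refl _ _) cube_mod)) //.
rewrite mulr_sumr coef_sum big1 // => m _.
rewrite mulrCA coefCM coefMXn; case: ltnP => [_|le_mN]; first by rewrite mulr0.
(* Either the coefficient of [H ^+ p] at this index vanishes, or [p] divides the scalar
   [2 * m + 1]. *)
have [dvd_p|ndvd_p] := boolP (p %| N - m * m.+1); last first.
  by rewrite coef_expp // mulr0.
have := prime_dvd_pronic p_prime dvdN le_mN dvd_p.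
by rewrite (dvdn_pcharf pcharFp) => /eqP->; rewrite mulr0 mul0r.
Qed.
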